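(* Let $(x_n)$ be a sequence in Schreier's space $S$. The following assertions are equivalent: (a) $(x_n)$ is $\mathcal{P}$-null; (b) $(x_n)$ is bounded in $S$ and $\|x_n\|_2\to 0$; (c) $(x_n)$ is bounded in $S$ and $\|x_n\|_\infty\to 0$.
   Context: A finite subset $A=\{n_1<\cdots<n_k\}$ of $\mathbb{N}=\{1,2,\dots\}$ is admissible if $k\le n_1$. Schreier's space $S$ is the completion of the space $c_{00}$ of finitely supported scalar sequences under the norm $\|x\|_S=\sup\{\sum_{j\in A}|x_j| : A\subset\mathbb{N}\text{ admissible}\}$. Elements of $S$ are regarded as scalar sequences; $S$ embeds algebraically and continuously in $\ell_2$ (and in $\ell_\infty$) by the natural inclusion, and $\|\cdot\|_2$, $\|\cdot\|_\infty$ denote the $\ell_2$ and $\ell_\infty$ norms. For a Banach space $E$, ${\mathcal P}({}^kE)$ is the space of scalar-valued continuous $k$-homogeneous polynomials on $E$. A sequence $(x_n)\subset E$ is $\mathcal{P}$-convergent to $x\in E$ if $P(x_n)\to P(x)$ for every $k\in\mathbb{N}$ and every $P\in{\mathcal P}({}^kE)$; it is $\mathcal{P}$-null if it is $\mathcal{P}$-convergent to $0$. *)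

(* Defs.v *)
From HB Require Import structures.
From mathcomp Require Import all_boot all_order all_algebra.
From mathcomp Require Import finmap complex.
From mathcomp Require Import all_classical all_reals all_analysis.

Set Implicit Arguments.
Unset Strict Implicit.
Unset Printing Implicit Defensive.

Import Order.TTheory GRing.Theory Num.Theory.
Import numFieldNormedType.Exports.

Local Open Scope classical_set_scope.
Local Open Scope ring_scope.

(* The scalar fields of interest are R and R[i], for
   R : realType; the structure below treats both at once.  It is needed because
   MathComp norms take their values in the scalar field itself, whereas suprema
   and the l_p norms of the library live in R. *)
HB.mixin Record isScalarField (R : realType) K & Num.NumField K := {
  of_real : R -> K;
  modulus : K -> R;
  of_realD : {morph of_real : r s / r + s};
  of_realM : {morph of_real : r s / r * s};
  ler_of_real : {mono of_real : r s / r <= s};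
  normr_modulus : forall x : K, `|x| = of_real (modulus x);
  modulus_complete : forall u : nat -> K,
    (forall e : R, 0 < e -> exists N, forall m n,
       (N <= m)%N -> (N <= n)%N -> modulus (u m - u n) < e) ->
    exists l : K, forall e : R, 0 < e -> exists N, forall n,
       (N <= n)%N -> modulus (u n - l) < e
}.

#[short(type="scalarFieldType")]
HB.structure Definition ScalarField (R : realType) :=
  {K of isScalarField R K & Num.NumField K}.

Section RealScalars.
Variable R : realType.

Lemma real_modulus_complete (u : nat -> R) :
  (forall e : R, 0 < e -> exists N, forall m n,
     (N <= m)%N -> (N <= n)%N -> `|u m - u n| < e) ->
  exists l : R, forall e : R, 0 < e -> exists N, forall n,
     (N <= n)%N -> `|u n - l| < e.
Proof.
move=> uC.
have /cauchy_cvgP/cvg_ex [l ul] : cauchy (u @ \oo).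
  apply/cauchy_ballP => e e0; have [N NP] := uC _ e0.
  pose T := u @` [set n | (N <= n)%N].
  have TF : (u @ \oo) T by exists N => // n Nn; exists n.
  by exists (T, T) => // -[_ _] [/= [m Nm <-] [n Nn <-]]; exact: NP.
exists l => e e0; have /cvgrPdist_lt/(_ e e0)[N _ NP] := ul.
by exists N => n /NP /=; rewrite distrC.
Qed.

HB.instance Definition _ := isScalarField.Build R R
  (fun _ _ => erefl) (fun _ _ => erefl) (fun _ _ => erefl)
  (fun=> erefl) real_modulus_complete.

End RealScalars.

Section ComplexScalars.
Variable R : realType.

Let cmod (z : R[i]) : R := complex.ComplexField.Normc.normc z.

Let cmod_Re (z : R[i]) : `|complex.Re z| <= cmod z.
Proof.
by case: z => a b /=; rewrite -sqrtr_sqr ler_sqrt ?lerDl ?addr_ge0 ?sqr_ge0.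
Qed.

Let cmod_Im (z : R[i]) : `|complex.Im z| <= cmod z.
Proof.
by case: z => a b /=; rewrite -sqrtr_sqr ler_sqrt ?lerDr ?addr_ge0 ?sqr_ge0.
Qed.

Let cmod_le (z : R[i]) : cmod z <= `|complex.Re z| + `|complex.Im z|.
Proof.
case: z => a b /=; rewrite -[leRHS]ger0_norm ?addr_ge0// -sqrtr_sqr.
rewrite ler_sqrt ?sqr_ge0// -[a ^+ 2]real_normK ?num_real//.
rewrite -[b ^+ 2]real_normK ?num_real// sqrrD lerD2r lerDl.
by rewrite mulrn_wge0// mulr_ge0.
Qed.

Lemma complex_modulus_complete (u : nat -> R[i]) :
  (forall e : R, 0 < e -> exists N, forall m n,
     (N <= m)%N -> (N <= n)%N -> cmod (u m - u n) < e) ->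
  exists l : R[i], forall e : R, 0 < e -> exists N, forall n,
     (N <= n)%N -> cmod (u n - l) < e.
Proof.
move=> uC.
have [a ua] : exists l : R, forall e : R, 0 < e -> exists N, forall n,
    (N <= n)%N -> `|complex.Re (u n) - l| < e.
  apply: real_modulus_complete => e /uC[N NP]; exists N => m n Nm Nn.
  by rewrite -raddfB; exact: le_lt_trans (cmod_Re _) (NP _ _ Nm Nn).
have [b ub] : exists l : R, forall e : R, 0 < e -> exists N, forall n,
    (N <= n)%N -> `|complex.Im (u n) - l| < e.
  apply: real_modulus_complete => e /uC[N NP]; exists N => m n Nm Nn.
  by rewrite -raddfB; exact: le_lt_trans (cmod_Im _) (NP _ _ Nm Nn).
exists (Complex a b) => e e0; have e20 : 0 < e / 2 by rewrite divr_gt0.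
have [[N NP] [M MP]] := (ua _ e20, ub _ e20).
exists (maxn N M) => n; rewrite geq_max => /andP[/NP aP /MP bP].
apply: le_lt_trans (cmod_le _) _; rewrite !raddfB/= [ltRHS]splitr.
exact: ltrD.
Qed.

Let of_realD : {morph (fun r : R => r%:C%C : R[i]) : r s / r + s}.
Proof. exact: raddfD. Qed.

Let of_realM : {morph (fun r : R => r%:C%C : R[i]) : r s / r * s}.
Proof. exact: rmorphM. Qed.

Let ler_of_real : {mono (fun r : R => r%:C%C : R[i]) : r s / r <= s}.
Proof. by move=> r s; rewrite lecR. Qed.

Let normr_cmod (z : R[i]) : `|z| = (cmod z)%:C%C.
Proof. by case: z. Qed.

HB.instance Definition _ := isScalarField.Build R R[i]
  of_realD of_realM ler_of_real normr_cmod complex_modulus_complete.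

End ComplexScalars.

Section ScalarTheory.
Context {R : realType} {K : scalarFieldType R}.
Implicit Types (r s : R) (x y : K).

Lemma of_real0 : of_real 0 = 0 :> K.
Proof. by apply: (addrI (of_real 0)); rewrite -of_realD !addr0. Qed.

Lemma of_real1 : of_real 1 = 1 :> K.
Proof.
have n0 : of_real 1 != 0 :> K.
  have : of_real (modulus (1 : K)) = 1 :> K by rewrite -normr_modulus normr1.
  move=> e; apply/eqP => e1; have /eqP := e.
  by rewrite -[modulus _]mulr1 of_realM e1 mulr0 eq_sym oner_eq0.
by apply: (mulfI n0); rewrite -of_realM !mulr1.
Qed.

Lemma ltr_of_real : {mono (of_real : R -> K) : r s / r < s}.
Proof. exact: leW_mono ler_of_real. Qed.

Lemma of_real_inj : injective (of_real : R -> K).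
Proof. exact: inc_inj ler_of_real. Qed.

Lemma modulus_ge0 x : 0 <= modulus x.
Proof. by rewrite -(ler_of_real (s := K)) of_real0 -normr_modulus. Qed.

Lemma modulusD x y : modulus (x + y) <= modulus x + modulus y.
Proof.
by rewrite -(ler_of_real (s := K)) of_realD -!normr_modulus ler_normD.
Qed.

Lemma modulusM x y : modulus (x * y) = modulus x * modulus y.
Proof. by apply: of_real_inj; rewrite of_realM -!normr_modulus normrM. Qed.

Lemma modulus0 : modulus (0 : K) = 0.
Proof. by apply: of_real_inj; rewrite of_real0 -normr_modulus normr0. Qed.

Lemma modulus_eq0 x : modulus x = 0 -> x = 0.
Proof.
by move=> x0; apply: normr0_eq0; rewrite normr_modulus x0 of_real0.
Qed.

Lemma modulusN x : modulus (- x) = modulus x.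
Proof. by apply: of_real_inj; rewrite -!normr_modulus normrN. Qed.

End ScalarTheory.

Section SchreierNorm.
Context {R : realType} {K : scalarFieldType R}.
Local Open Scope ereal_scope.
Implicit Types x y : nat -> K^o.

(* Coordinates are numbered from 0: index n stands for the integer n + 1 of
   N = {1, 2, ...}, whence [n.+1]. *)
Definition admissible (A : {fset nat}) : Prop :=
  forall n, n \in A -> (#|` A| <= n.+1)%N.

Definition schreier_norm x : \bar R :=
  ereal_sup [set (\sum_(j <- A) modulus (x j))%:E | A in admissible].

Definition finitely_supported x : Prop :=
  exists N, forall n, (N <= n)%N -> x n = 0%R.

(* The closure of c_00 in the sequences of finite norm: this is the completion
   of c_00, see the completeNormedModType instance, [schreier_c00_dense] and
   [schreier_normE] below. *)
Definition in_schreier x : Prop :=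
  forall e : R, (0 < e)%R ->
    exists2 y, finitely_supported y & schreier_norm (x - y)%R < e%:E.

Definition schreier_pred : {pred nat -> K^o} := fun x => `[< in_schreier x >].

Lemma schreier_normD x y :
  schreier_norm (x + y)%R <= schreier_norm x + schreier_norm y.
Proof.
apply: ge_ereal_sup => _ [A Aadm <-].
apply: le_trans (_ : (\sum_(j <- A) modulus (x j))%:E +
                     (\sum_(j <- A) modulus (y j))%:E <= _).
  rewrite -EFinD lee_fin -big_split/=.
  by apply: ler_sum => j _; exact: modulusD.
by apply: leeD; apply: ereal_sup_ubound; exists A.
Qed.

Lemma admissible0 : admissible fset0.
Proof. by move=> n; rewrite inE. Qed.

Lemma admissible1 n : admissible [fset n]%fset.
Proof. by move=> m _; rewrite cardfs1. Qed.

Lemma schreier_norm_ge0 x : 0 <= schreier_norm x.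
Proof.
apply: ereal_sup_ubound; exists fset0; first exact: admissible0.
by rewrite big_seq_fset0.
Qed.

Lemma schreier_norm0 : schreier_norm 0%R = 0.
Proof.
apply/eqP; rewrite eq_le schreier_norm_ge0 andbT.
apply: ge_ereal_sup => _ [A _ <-]; rewrite big1// => j _.
exact: modulus0.
Qed.

Lemma modulus_le_schreier x n : (modulus (x n))%:E <= schreier_norm x.
Proof.
apply: ereal_sup_ubound; exists [fset n]%fset; first exact: admissible1.
by rewrite big_seq_fset1.
Qed.

Lemma le_schreier_normZ (a : K) x :
  schreier_norm (a *: x)%R <= (modulus a)%:E * schreier_norm x.
Proof.
apply: ge_ereal_sup => _ [A Aadm <-].
have -> : (\sum_(j <- A) modulus ((a *: x) j) =
           modulus a * \sum_(j <- A) modulus (x j))%R.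
  by rewrite mulr_sumr; apply: eq_bigr => j _; exact: modulusM.
rewrite EFinM; apply: lee_wpmul2l; first by rewrite lee_fin modulus_ge0.
by apply: ereal_sup_ubound; exists A.
Qed.

Lemma schreier_normN x : schreier_norm (- x)%R = schreier_norm x.
Proof.
by congr ereal_sup; apply: eq_imagel => A _; congr EFin; apply: eq_bigr => j _;
  exact: modulusN.
Qed.

Lemma schreier_norm_c00 y : finitely_supported y -> schreier_norm y < +oo.
Proof.
move=> [N yN]; pose S := (\sum_(i < N) modulus (y i))%R.
have S0 : (0 <= S)%R by apply: sumr_ge0 => i _; exact: modulus_ge0.
have leS j : (modulus (y j) <= S)%R.
  have [jN|/yN ->] := ltnP j N; last by rewrite modulus0.
  rewrite /S (bigD1 (Ordinal jN))//= lerDl.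
  by apply: sumr_ge0 => i _; exact: modulus_ge0.
apply: le_lt_trans (ltry (N%:R * S)); apply: ge_ereal_sup => _ [A Aadm <-].
rewrite lee_fin; have [/hasP[j jA jN]|/hasPn AN] := boolP (has (fun j => j < N)%N A).
  apply: le_trans (_ : \sum_(j <- A) S <= _)%R; first by apply: ler_sum.
  rewrite big_const_seq count_predT iter_addr_0 -[leLHS]mulr_natl ler_wpM2r// ler_nat.
  exact: leq_trans (Aadm _ jA) jN.
rewrite big_seq big1 ?mulr_ge0// => j /AN; rewrite -leqNgt => /yN ->.
exact: modulus0.
Qed.

Lemma finitely_supported0 : finitely_supported 0%R.
Proof. by exists 0%N. Qed.

Lemma finitely_supportedD x y : finitely_supported x -> finitely_supported y ->
  finitely_supported (x + y)%R.
Proof.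
move=> [N xN] [M yM]; exists (maxn N M) => n; rewrite geq_max => /andP[nN nM].
by rewrite -[LHS]/(x n + y n)%R xN// yM// addr0.
Qed.

Lemma finitely_supportedZ a x : finitely_supported x ->
  finitely_supported (a *: x)%R.
Proof.
by move=> [N xN]; exists N => n /xN xn; rewrite -[LHS]/(a * x n)%R xn mulr0.
Qed.

Lemma c00_schreier x : finitely_supported x -> in_schreier x.
Proof. by move=> xf e e0; exists x => //; rewrite subrr schreier_norm0 lte_fin. Qed.

Lemma schreier_norm_fin x : in_schreier x -> schreier_norm x \is a fin_num.
Proof.
move=> /(_ _ ltr01)[y yf xy]; rewrite ge0_fin_numE ?schreier_norm_ge0//.
rewrite -[x](subrK y); apply: le_lt_trans (schreier_normD _ _) _.
by apply: lte_add_pinfty; [exact: lt_trans xy (ltry _)|exact: schreier_norm_c00].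
Qed.

Lemma schreier_submod_closed : submod_closed schreier_pred.
Proof.
split; first by apply/asboolP/c00_schreier/finitely_supported0.
move=> a u v /asboolP uS /asboolP vS; apply/asboolP => e e0.
have a1 : (0 < modulus a + 1)%R by rewrite ltr_wpDl ?modulus_ge0.
have d0 : (0 < e / 2 / (modulus a + 1))%R by rewrite !divr_gt0.
have [x xf ux] := uS _ d0; have [y yf vy] := vS (e / 2)%R ltac:(by rewrite divr_gt0).
exists (a *: x + y)%R; first exact: finitely_supportedD (finitely_supportedZ _ _) _.
rewrite opprD addrACA -scalerBr; apply: le_lt_trans (schreier_normD _ _) _.
rewrite [e]splitr EFinD; apply: lteD => //.
apply: le_lt_trans (le_schreier_normZ _ _) _.
have uxf : schreier_norm (u - x)%R \is a fin_num.
  by rewrite ge0_fin_numE ?schreier_norm_ge0//; exact: lt_trans ux (ltry _).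
rewrite -(fineK uxf) -EFinM lte_fin.
have {}ux : (fine (schreier_norm (u - x)) < e / 2 / (modulus a + 1))%R.
  by rewrite -lte_fin fineK.
apply: le_lt_trans (_ : (modulus a + 1) * fine (schreier_norm (u - x)) < _)%R.
  by rewrite ler_wpM2r ?fine_ge0 ?schreier_norm_ge0// lerDl.
by rewrite mulrC -ltr_pdivlMr.
Qed.

End SchreierNorm.

HB.instance Definition _ (R : realType) (K : scalarFieldType R) :=
  GRing.isSubmodClosed.Build K (nat -> K^o) schreier_pred
    schreier_submod_closed.

Record schreier (R : realType) (K : scalarFieldType R) := Schreier {
  schreier_seq :> nat -> K^o;
  schreier_seqP : schreier_seq \in schreier_pred
}.

Section SchreierSpace.
Context {R : realType} {K : scalarFieldType R}.

HB.instance Definition _ := [isSub for @schreier_seq R K].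
HB.instance Definition _ := [Choice of schreier K by <:].
HB.instance Definition _ := [SubChoice_isSubLmodule of schreier K by <:].

Implicit Types x y : schreier K.

Lemma schreier_fin x : schreier_norm x \is a fin_num.
Proof. exact/schreier_norm_fin/asboolP/(schreier_seqP x). Qed.

Let norm x : K := of_real (fine (schreier_norm x)).

Let ler_normD x y : norm (x + y) <= norm x + norm y.
Proof.
rewrite -of_realD ler_of_real -lee_fin EFinD !fineK ?schreier_fin//.
exact: schreier_normD.
Qed.

Let le_normrZ (a : K) x : norm (a *: x) <= `|a| * norm x.
Proof.
rewrite normr_modulus -of_realM ler_of_real -lee_fin EFinM !fineK ?schreier_fin//.
exact: le_schreier_normZ.
Qed.

Let normrZ (a : K) x : norm (a *: x) = `|a| * norm x.
Proof.
apply/eqP; rewrite eq_le le_normrZ/=; have [->|a0] := eqVneq a 0.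
  by rewrite normr0 mul0r -of_real0 ler_of_real fine_ge0// schreier_norm_ge0.
rewrite -ler_pdivlMl ?normr_gt0// -normfV -{1}[x](scalerK a0).
exact: le_normrZ.
Qed.

Let normr0_eq0 x : norm x = 0 -> x = 0.
Proof.
rewrite -of_real0 => /of_real_inj x0; apply/val_inj/funext => n /=.
apply: modulus_eq0; apply/eqP; rewrite eq_le modulus_ge0 andbT -lee_fin.
by rewrite -x0 fineK ?schreier_fin ?modulus_le_schreier.
Qed.

HB.instance Definition _ := Lmodule_isNormed.Build K (schreier K)
  ler_normD normrZ normr0_eq0.

Lemma schreier_normE x : `|x| = of_real (fine (schreier_norm x)).
Proof. by []. Qed.

End SchreierSpace.

Section SchreierComplete.
Context {R : realType} {K : scalarFieldType R}.
Implicit Types x y : schreier K.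

Lemma norm_ltE x (e : R) : (`|x| < of_real e) = (schreier_norm x < e%:E)%E.
Proof. by rewrite schreier_normE ltr_of_real -lte_fin fineK// schreier_fin. Qed.

Lemma gt0_of_real (e : K) : 0 < e -> exists2 d : R, 0 < d & e = of_real d.
Proof.
move=> e0; have ee : e = of_real (modulus e) by rewrite -normr_modulus gtr0_norm.
by exists (modulus e) => //; rewrite -(ltr_of_real (K := K)) of_real0 -ee.
Qed.

Lemma schreier_cauchy_cvg (F : set_system (schreier K)) :
  ProperFilter F -> cauchy F -> cvg F.
Proof.
move=> FF /cauchyP F_cauchy.
have ex n : exists x, F (ball x (of_real (n.+1%:R^-1 : R) : K)).
  by apply: F_cauchy; rewrite -of_real0 ltr_of_real.
have {ex}[u Fu] := choice ex.
have uu m n : (schreier_norm ((u m - u n)%R : schreier K) <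
    (m.+1%:R^-1 + n.+1%:R^-1)%:E)%E.
  have [z [zm zn]] := filter_ex (filterI (Fu m) (Fu n)).
  rewrite -norm_ltE of_realD -(subrKA z); apply: le_lt_trans (ler_normD _ _) _.
  by move: zm zn; rewrite -!ball_normE/= => zm zn; rewrite ltrD// distrC.
have inv_small (e : R) : 0 < e -> exists N, forall n, (N <= n)%N -> n.+1%:R^-1 < e.
  move=> e0; exists (Num.bound e^-1) => n nN; rewrite invf_plt ?posrE//.
  have := archi_boundP (ltW (_ : 0 < e^-1)); rewrite invr_gt0 => /(_ e0) h.
  by apply: lt_le_trans h _; rewrite ler_nat; exact: leqW.
have lim j : exists l : K, forall e : R, 0 < e -> exists N, forall n,
    (N <= n)%N -> modulus (u n j - l) < e.
  apply: modulus_complete => e e0.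
  have [N NP] := inv_small (e / 2) ltac:(by rewrite divr_gt0).
  exists N => m n /NP Nm /NP Nn; rewrite -lte_fin.
  apply: le_lt_trans (modulus_le_schreier (u m - u n : schreier K) j) _.
  by apply: lt_trans (uu _ _) _; rewrite lte_fin [ltRHS]splitr ltrD.
have {lim}[l ul] := choice lim.
have ul_le n : (schreier_norm ((u n : nat -> K^o) - l)%R <= (n.+1%:R^-1)%:E)%E.
  apply: ge_ereal_sup => _ [A Aadm <-]; apply/lee_addgt0Pr => e e0.
  have e20 : 0 < e / 2 by rewrite divr_gt0.
  pose c : R := (size A).+1%:R; have c0 : 0 < c by [].
  have eA : exists M, forall j, j \in (A : seq nat) -> forall m, (M <= m)%N ->
      modulus (u m j - l j) < e / 2 / c.
    elim: (A : seq nat) => [|j s [M MP]]; first by exists 0%N.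
    have [N NP] := ul j (e / 2 / c) ltac:(by rewrite divr_gt0).
    exists (maxn N M) => i + m; rewrite geq_max inE => /orP[/eqP ->|iS] /andP[Nm Mm].
      exact: NP.
    exact: MP.
  have [M MP] := eA; have [N NP] := inv_small _ e20.
  pose m := maxn M N.
  have Nm : m.+1%:R^-1 < e / 2 by apply: NP; rewrite leq_maxr.
  rewrite -EFinD lee_fin.
  apply: le_trans (_ : \sum_(j <- A) (modulus (u n j - u m j) +
                                      modulus (u m j - l j)) <= _).
    by apply: ler_sum => j _; apply: le_trans (modulusD _ _); rewrite subrKA.
  rewrite big_split/= [e in leRHS]splitr addrA.
  apply: lerD.
    have h : ((\sum_(j <- A) modulus (u n j - u m j))%:E <=
        schreier_norm ((u n - u m)%R : schreier K))%E.
      by apply: ereal_sup_ubound; exists A.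
    rewrite -lee_fin; apply: le_trans h _; apply: le_trans (ltW (uu n m)) _.
    by rewrite lee_fin lerD2l ltW.
  apply: le_trans (_ : \sum_(j <- A) (e / 2 / c) <= _).
    by rewrite big_seq [leRHS]big_seq; apply: ler_sum => j jA;
      rewrite ltW// MP// leq_maxl.
  rewrite big_const_seq count_predT iter_addr_0 -[leLHS]mulr_natr.
  rewrite -mulrA ler_piMr ?(ltW e20)// mulrC ler_pdivrMr// mul1r ler_nat.
  exact: leqnSn.
have lS : (l : nat -> K^o) \in schreier_pred.
  apply/asboolP => e e0.
  have [N NP] := inv_small (e / 2) ltac:(by rewrite divr_gt0).
  have /asboolP/(_ (e / 2) ltac:(by rewrite divr_gt0))[y yf uy] := schreier_seqP (u N).
  exists y => //; rewrite -(subrKA (u N : nat -> K^o)).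
  apply: le_lt_trans (schreier_normD _ _) _; rewrite [e]splitr EFinD.
  apply: lteD => //; rewrite -opprB schreier_normN.
  by apply: le_lt_trans (ul_le N) _; rewrite lte_fin NP.
apply/cvg_ex; exists (Schreier lS); apply/cvgrPdist_lt => e /gt0_of_real[d d0 ->].
have [N NP] := inv_small (d / 2) ltac:(by rewrite divr_gt0).
apply: filterS (Fu N) => z; rewrite -ball_normE/= => uz.
rewrite -(subrKA (u N)); apply: le_lt_trans (ler_normD _ _) _.
rewrite [d]splitr of_realD; apply: ltrD; last first.
  by apply: lt_trans uz _; rewrite ltr_of_real NP.
rewrite distrC norm_ltE; apply: le_lt_trans (ul_le N) _.
by rewrite lte_fin NP.
Qed.

HB.instance Definition _ := Uniform_isComplete.Build (schreier K)
  schreier_cauchy_cvg.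

Lemma schreier_c00_dense :
  closure [set x : schreier K | finitely_supported x] = setT.
Proof.
apply/seteqP; split=> // x _ B /nbhs_ballP[e /= /gt0_of_real[d d0 ->] xB].
have /asboolP/(_ d d0)[y yf xy] := schreier_seqP x.
have yS : y \in schreier_pred by exact/asboolP/c00_schreier.
exists (Schreier yS); split => //; apply: xB; rewrite -ball_normE/=.
by rewrite norm_ltE.
Qed.

End SchreierComplete.

Section LpNorms.
Context {R : realType} {K : scalarFieldType R}.

(* The l_p norm of the library is the L_p norm for the counting measure. *)
Definition l2_norm (x : nat -> K) : \bar R :=
  Lnorm counting 2%:E (fun j => (modulus (x j))%:E).

Definition linfty_norm (x : nat -> K) : \bar R :=
  Lnorm counting +oo%E (fun j => (modulus (x j))%:E).

End LpNorms.

Section Polynomials.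
Context {K : numFieldType} {E : normedModType K}.

Definition multilinear k (M : ('I_k -> E) -> K^o) : Prop :=
  forall (i : 'I_k) (v : 'I_k -> E),
    linear (fun z : E => M (@dfwith _ (fun=> E) v i z)).

Definition homogeneous_polynomial k (P : E -> K^o) : Prop :=
  exists2 M : ('I_k -> E) -> K^o, multilinear M & forall x, P x = M (fun=> x).

Definition polynomially_cvg (u : nat -> E) (l : E) : Prop :=
  forall k, (0 < k)%N -> forall P : E -> K^o,
    homogeneous_polynomial k P -> continuous P -> P (u n) @[n --> \oo] --> P l.

Definition polynomially_null (u : nat -> E) : Prop := polynomially_cvg u 0.

End Polynomials.

(* Main.v *)
(* (c) => (a): if ||x_n||_S <= C, ||x_n||_oo -> 0 and ||u||_S < B with C < B, then
   ||u + x_n||_S < B for large n, since an admissible set meeting the essential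
   support of u has bounded cardinality.  For a real polynomial f, induction on
   the degree gives f (u + x_n) - f (x_n) -> f u - f 0; taking u with f u close
   to the supremum of f on the ball of radius B, this forces
   limsup f (x_n) <= f 0, and likewise for - f.  Complex polynomials are handled
   through their real and imaginary parts.

   (c) => (b): the upper half of {j : |x_j| >= t} is admissible, so this set has
   at most 2 ||x||_S / t elements; a dyadic decomposition then gives
   ||x||_2 ^ 2 <= 8 ||x||_S ||x||_oo.

   (a) => boundedness and (c): a Baire category argument on sequences t in T^N,
   applied to \sum_k 2^-k t_k (x) with t_k functionals of norm at most 1, and to
   \sum_k t_k x_k ^ 2 with t_k in {0, 1}. *)
Require Import Defs.
From mathcomp Require Import all_boot all_order all_algebra finmap complex lra zify.
From mathcomp Require Import all_classical all_reals all_analysis ess_sup_inf.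
Import Order.TTheory GRing.Theory Num.Theory.
Import numFieldNormedType.Exports.

Set Implicit Arguments.
Unset Strict Implicit.
Unset Printing Implicit Defensive.

Local Open Scope classical_set_scope.
Local Open Scope ring_scope.

(** * Polynomials defined by vanishing iterated differences *)

Section Frechet.
Variables (E V W : zmodType).

(* f is a polynomial of degree at most k in the sense of Frechet: its iterated
   differences of order k + 1 vanish. *)
Fixpoint frechet (U : zmodType) k (f : E -> U) : Prop :=
  if k is k'.+1 then forall u, frechet k' (fun x => f (u + x) - f x)
  else forall u x, f (u + x) = f x.

Lemma frechet_cst0 k : frechet k (fun=> 0 : V).
Proof. by elim: k => //= k IHk u; rewrite subrr. Qed.

Lemma frechetD k (f g : E -> V) : frechet k f -> frechet k g ->
  frechet k (fun x => f x + g x).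
Proof.
elim: k f g => /= [f g f0 g0 u x|k IHk f g fk gk u]; first by rewrite f0 g0.
have := IHk _ _ (fk u) (gk u); congr frechet.
by apply/funext => x; rewrite opprD addrACA.
Qed.

Lemma frechet_comp k (f : E -> V) (phi : V -> W) :
  {morph phi : a b / a - b} -> frechet k f -> frechet k (fun x => phi (f x)).
Proof.
move=> phiB; elim: k f => /= [f f0 u x|k IHk f fk u]; first by rewrite f0.
by have := IHk _ (fk u); congr frechet; apply/funext => x; rewrite phiB.
Qed.

End Frechet.

(** * Multilinear maps restricted to the diagonal *)

Section Multilinear.
Context {K : numFieldType} {E : normedModType K} {k : nat}.
Variable M : ('I_k -> E) -> K^o.
Hypothesis Mlin : multilinear M.

Lemma dfwith_if (v : 'I_k -> E) i z :
  @dfwith _ (fun=> E) v i z = (fun j => if j == i then z else v j).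
Proof.
by apply/funext => j; case: dfwithP => [|{}j ij]; rewrite ?eqxx// eq_sym (negPf ij).
Qed.

Lemma multilinearP (v : 'I_k -> E) i a y z :
  M (fun j => if j == i then a *: y + z else v j) =
  a * M (fun j => if j == i then y else v j) +
  M (fun j => if j == i then z else v j).
Proof. by have := Mlin i v a y z; rewrite !dfwith_if. Qed.

(** Slots are scaled one at a time along a duplicate-free list: additivity makes [M] vanish when a
    slot is 0, so [multilinearP] with [z = 0] pulls out one factor [a]. *)
Lemma multilinear_diag_scale a x : M (fun=> a *: x) = a ^+ k * M (fun=> x).
Proof.
have H (s : seq 'I_k) : uniq s ->
    M (fun i => if i \in s then a *: x else x) = a ^+ size s * M (fun=> x).
  elim: s => [_|i s IHs /= /andP[is_ us]].
    by rewrite expr0 mul1r; congr M; apply/funext.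
  have M0 : M (fun j => if j == i then 0 else if j \in s then a *: x else x) = 0.
    have := multilinearP (fun j => if j \in s then a *: x else x) i 1 0 0.
    by rewrite scaler0 addr0 mul1r -[X in X = _]addr0 => /addrI.
  have := multilinearP (fun j => if j \in s then a *: x else x) i a x 0.
  rewrite addr0 M0 addr0 exprS -mulrA -IHs// => e; rewrite -[RHS]/(a * _).
  transitivity (M (fun j => if j == i then a *: x else if j \in s then a *: x else x)).
    by congr M; apply/funext => j; rewrite inE; case: eqP.
  rewrite e; congr (a * M _); apply/funext => j.
  by case: eqP => // ->; rewrite (negPf is_).
have := H (enum 'I_k) (enum_uniq _); rewrite size_enum_ord => <-.
by congr M; apply/funext => i; rewrite mem_enum.
Qed.

(** The difference in direction [u] telescopes over the slots of [S] into terms with one slot frozen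
    to [u], where [x] occupies one slot fewer. The offset [v] makes the induction go through: it
    stores frozen slots and earlier shifts. *)
Lemma frechet_multilinear m (S : {set 'I_k}) (v : 'I_k -> E) : #|S| = m ->
  frechet m (fun x => M (fun i => (if i \in S then x else 0) + v i)).
Proof.
elim: m S v => [S v /cards0_eq -> u x|m IHm S v Sm u].
  by congr M; apply/funext => i; rewrite inE.
(* [w s] shifts by [u] exactly the slots listed in [s]; for [s = enum S] this turns [x] into [u + x]
   in every slot of [S]. *)
pose w (s : seq 'I_k) i := if i \in s then u + v i else v i.
have H (s : seq 'I_k) : {subset s <= S} -> uniq s ->
    frechet m (fun x => M (fun i => (if i \in S then x else 0) + w s i) -
                        M (fun i => (if i \in S then x else 0) + v i)).
  elim: s => [_ _|i s IHs sS /= /andP[is_ us]].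
    have := frechet_cst0 E K^o m; congr frechet; apply/funext => x.
    by rewrite -[X in X - _]/(M _) subrr.
  have iS : i \in S by apply: sS; rewrite inE eqxx.
  have {}IHs := IHs (fun j js => sS j ltac:(by rewrite inE js orbT)) us.
  have Sim : #|S :\ i| = m by move: Sm; rewrite (cardsD1 i) iS => -[].
  have := frechetD (IHm (S :\ i) (fun j => if j == i then u else w s j) Sim) IHs.
  congr frechet; apply/funext => x; rewrite addrA; congr (_ - _).
  have := multilinearP (fun j => (if j \in S then x else 0) + w s j) i 1 u (x + v i).
  rewrite scale1r mul1r => e; apply: etrans (etrans _ (esym e)) _.
    congr (M _ + M _); apply/funext => j; rewrite ?inE; case: eqP => // ->.
      by rewrite add0r.
    by rewrite iS /w (negPf is_).
  congr M; apply/funext => j; rewrite /w inE; case: eqP => [->|//].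
  by rewrite iS addrCA.
have := H (enum S) (fun i => ltac:(by rewrite mem_enum)) (enum_uniq _).
congr frechet; apply/funext => x; congr (M _ - _); apply/funext => i.
by rewrite /w mem_enum; case: ifP => // _; rewrite addrCA addrA.
Qed.

End Multilinear.

Lemma frechet_homogeneous {K : numFieldType} {E : normedModType K} k (P : E -> K^o) :
  homogeneous_polynomial k P -> frechet k P.
Proof.
move=> [M Mlin PE]; have := frechet_multilinear Mlin (fun=> 0) (cardsT 'I_k).
rewrite card_ord; congr frechet; apply/funext => x; rewrite PE.
by congr M; apply/funext => i; rewrite inE addr0.
Qed.

(** * Convergence of real polynomials along a sequence *)

Section FrechetNull.
Context {R : realType} {E : zmodType}.
Variables (N : E -> R) (x : nat -> E) (C : R).
Hypothesis N0 : N 0 <= C.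
Hypothesis ND : forall u v, N (u + v) <= N u + N v.
(** Translating a given point by a late [x n] does not leave the sublevel set [N < B]. For the
    Schreier norm this is supplied by [snorm_add_near]. *)
Hypothesis Nx : forall B u, C < B -> N u < B -> \forall n \near \oo, N (u + x n) < B.

(* If f almost attains its supremum over the ball N < C + 1 at u, then
   f (u + x n), which is close to f u + f (x n) - f 0 since the degree drops in
   f (u + _) - f, cannot exceed f u by much. *)
Lemma frechet_cvg k (f : E -> R) : frechet k f ->
  (forall r, exists c, forall u, N u <= r -> `|f u| <= c) ->
  f (x n) @[n --> \oo] --> f 0.
Proof.
elim: k f => [f f0 _|k IHk].
  rewrite (_ : (fun n => f (x n)) = fun=> f 0); first exact: cvg_cst.
  by apply/funext => n; rewrite -[x n]addr0 f0.
have upper (f : E -> R) : frechet k.+1 f ->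
    (forall r, exists c, forall u, N u <= r -> `|f u| <= c) ->
    forall e, 0 < e -> \forall n \near \oo, f (x n) < f 0 + e.
  move=> fk fb e e0; have e20 : 0 < e / 2 by rewrite divr_gt0.
  pose A := f @` [set u | N u < C + 1].
  have supA : has_sup A.
    split; first by exists (f 0), 0 => //=; rewrite (le_lt_trans N0)// ltrDl.
    have [c cP] := fb (C + 1); exists c => _ [u /= /ltW uC <-].
    exact: le_trans (ler_norm _) (cP _ uC).
  have [_ [u /= uC <-] fu] := sup_adherent e20 supA.
  have /cvgrPdist_lt/(_ _ e20) h : f (u + x n) - f (x n) @[n --> \oo] --> f (u + 0) - f 0.
    apply: (IHk (fun x => f (u + x) - f x)) => // r.
    (* Subadditivity of [N] puts the translated argument at level at most [N u + r]. *)
    have [[c1 c1P] [c2 c2P]] := (fb (N u + r), fb r).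
    exists (c1 + c2) => v vr; apply: le_trans (ler_normB _ _) _.
    by rewrite lerD ?c1P ?c2P// (le_trans (ND _ _))// lerD2l.
  near=> n.
  have fuxn : f (u + x n) <= sup A.
    apply: sup_upper_bound => //; exists (u + x n) => //=.
    by near: n; apply: Nx => //; rewrite ltrDl.
  have : `|f (u + 0) - f 0 - (f (u + x n) - f (x n))| < e / 2 by near: n.
  rewrite addr0 ltr_norml => /andP[]; move: fu fuxn; lra.
move=> f fk fb; apply/cvgrPdist_lt => e e0.
have fNk : frechet k.+1 (fun u => - f u).
  by apply: frechet_comp fk => a b; rewrite opprB addrC opprK.
have fNb r : exists c, forall u, N u <= r -> `|- f u| <= c.
  by have [c cP] := fb r; exists c => u /cP; rewrite normrN.
near=> n; rewrite ltr_norml.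
have : f (x n) < f 0 + e by near: n; exact: upper.
have : - f (x n) < - f 0 + e by near: n; exact: (upper (fun u => - f u)).
by lra.
Unshelve. all: by end_near. Qed.

End FrechetNull.

(** * Boundedness of continuous homogeneous polynomials *)

Lemma modulus_of_real {R : realType} {K : scalarFieldType R} (r : R) :
  0 <= r -> modulus (of_real r : K) = r.
Proof.
move=> r0; apply: (@of_real_inj R K); rewrite -normr_modulus ger0_norm//.
by rewrite -of_real0 ler_of_real.
Qed.

Lemma modulusX {R : realType} {K : scalarFieldType R} (a : K) k :
  modulus (a ^+ k) = modulus a ^+ k.
Proof.
elim: k => [|k IHk]; first by rewrite !expr0 -of_real1 modulus_of_real.
by rewrite !exprS modulusM IHk.
Qed.

(** Continuity at 0 bounds [P] on a small ball, and homogeneity carries the bound to the ball of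
    radius [r]. *)
Lemma homogeneous_bounded {R : realType} {K : scalarFieldType R}
    {E : normedModType K} k (P : E -> K^o) :
  homogeneous_polynomial k P -> {for 0, continuous P} ->
  forall r : R, 0 <= r -> exists c : R, forall u, `|u| <= of_real r -> modulus (P u) <= c.
Proof.
move=> [M Mlin PM] /cvgrPdist_lt/(_ 1 ltr01)/nbhs_ballP[e0 /= /gt0_of_real[e e_gt0 ->]].
(* Dividing by [r + 1] rather than [r] allows [r = 0] and makes [t * r < e] strict. *)
move=> Pe r r0; pose t := e / (r + 1).
have r1 : 0 < r + 1 by rewrite ltr_wpDl.
have t0 : 0 < t by rewrite divr_gt0.
have tn0 : of_real t != 0 :> K by rewrite -of_real0 (inj_eq of_real_inj) gt_eqF.
exists (modulus ((of_real t)^-1 : K) ^+ k * (modulus (P 0) + 1)) => u ur.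
have {1}-> : u = (of_real t)^-1 *: (of_real t *: u) by rewrite scalerA mulVf// scale1r.
rewrite PM (multilinear_diag_scale Mlin) -PM modulusM modulusX.
rewrite ler_wpM2l ?exprn_ge0 ?modulus_ge0//.
have : `|P 0 - P (of_real t *: u)| < 1.
  apply: Pe; rewrite -ball_normE/= sub0r normrN normrZ normr_modulus modulus_of_real ?(ltW t0)//.
  apply: (@le_lt_trans _ _ (of_real t * of_real r)).
    by rewrite ler_wpM2l// -of_real0 ler_of_real ltW.
  rewrite -of_realM ltr_of_real /t mulrAC ltr_pdivrMr// ltr_pM2l//.
  by rewrite ltrDl.
rewrite normr_modulus -of_real1 ltr_of_real => P1.
rewrite -[X in modulus X](subKr (P 0)); apply: le_trans (modulusD _ _) _.
by rewrite modulusN lerD2l ltW.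
Qed.

(** * The Schreier norm under perturbations small in sup norm *)

Section SchreierGrow.
Context {R : realType} {K : scalarFieldType R}.
Implicit Types (x u v : schreier K).

Definition snorm (u : schreier K) : R := fine (schreier_norm u).

Lemma snormE u : `|u| = of_real (snorm u) :> K.
Proof. exact: schreier_normE. Qed.

Lemma snormD u v : snorm (u + v) <= snorm u + snorm v.
Proof. by rewrite -(ler_of_real (s := K)) of_realD -!snormE ler_normD. Qed.

Lemma snorm0 : snorm 0 = 0.
Proof. by apply: (@of_real_inj R K); rewrite -snormE normr0 of_real0. Qed.

Lemma snorm_ge0 u : 0 <= snorm u.
Proof. by rewrite fine_ge0// schreier_norm_ge0. Qed.

Lemma EFin_snorm u : (snorm u)%:E = schreier_norm u.
Proof. by rewrite fineK// schreier_fin. Qed.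

Lemma admissible_sum_le u (A : {fset nat}) : admissible A ->
  \sum_(j <- A) modulus (u j) <= snorm u.
Proof. by move=> Aadm; rewrite -lee_fin EFin_snorm; apply: ereal_sup_ubound; exists A. Qed.

Lemma snorm_le u c :
  (forall A, admissible A -> \sum_(j <- A) modulus (u j) <= c) -> snorm u <= c.
Proof.
move=> uc; rewrite -lee_fin EFin_snorm; apply: ge_ereal_sup => _ [A Aadm <-].
by rewrite lee_fin uc.
Qed.

Lemma modulus_le_snorm u j : modulus (u j) <= snorm u.
Proof. by rewrite -lee_fin EFin_snorm modulus_le_schreier. Qed.

(* An admissible set meeting the (essential) support of u has bounded
   cardinality, so it sees little of x n; otherwise it does not see u. *)
Lemma snorm_add_near (x : nat -> schreier K) (C : R) :
  (forall n, snorm (x n) <= C) ->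
  (forall e : R, 0 < e -> \forall n \near \oo, forall j, modulus (x n j) <= e) ->
  forall (B : R) u, C < B -> snorm u < B -> \forall n \near \oo, snorm (u + x n) < B.
Proof.
move=> xC x0 B u CB uB.
(* The gap [B - m = 4 * d] is spent on [u - v], on the excess of [snorm v] over [snorm u], and on
   the part of [x n] seen by an admissible set; one [d] is left for strictness. The maximum with [C]
   serves the sets that miss the support of [v]. *)
pose m := Num.max (snorm u) C; have mB : m < B by rewrite gt_max uB CB.
pose d := (B - m) / 4; have d0 : 0 < d by rewrite divr_gt0// subr_gt0.
have /asboolP/(_ d d0)[v0 [p vp] uv] := schreier_seqP u.
have v0S : v0 \in schreier_pred by apply/asboolP/c00_schreier; exists p.
pose v : schreier K := Schreier v0S.
have {}uv : snorm (u - v) < d by rewrite -lte_fin EFin_snorm.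
have vu : snorm v <= snorm u + d.
  rewrite -(ler_of_real (s := K)) of_realD -!snormE -lerBlDl.
  apply: le_trans (lerB_dist _ _) _; rewrite distrC snormE ler_of_real ltW//.
have p1 : 0 < p.+1%:R :> R by [].
near=> n.
(* An admissible set with an element below [p] has at most [p] elements, so these bounds sum to at
   most [d]; the successor covers [p = 0]. *)
have xn j : modulus (x n j) <= d / p.+1%:R.
  by move: j; near: n; apply: x0; rewrite divr_gt0.
apply: (@le_lt_trans _ _ (m + 3 * d)); last by rewrite /d; move: mB; lra.
have -> : u + x n = (u - v) + (v + x n) by rewrite addrA subrK.
have mu : snorm u <= m by rewrite le_max lexx.
have mC : C <= m by rewrite le_max lexx orbT.
apply: le_trans (snormD _ _) _.
suff : snorm (v + x n) <= m + 2 * d by move: uv; lra.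
apply: snorm_le => A Aadm.
have [/hasP[j jA jp]|/hasPn Ap] := boolP (has (fun j => j < p)%N A).
  apply: (@le_trans _ _ (\sum_(j <- A) modulus (v j) + \sum_(j <- A) (d / p.+1%:R))).
    rewrite -big_split/=; apply: ler_sum => i _; apply: le_trans (modulusD _ _) _.
    by rewrite lerD2l.
  have : \sum_(j <- A) modulus (v j) <= snorm v by exact: admissible_sum_le.
  suff : \sum_(j <- A) (d / p.+1%:R) <= d by move: vu mu; lra.
  rewrite big_const_seq count_predT iter_addr_0 -[leLHS]mulr_natr mulrAC.
  rewrite ler_pdivrMr// ler_pM2l// ler_nat.
  by rewrite (leq_trans (Aadm _ jA))// (leq_trans jp).
apply: (@le_trans _ _ C); last by rewrite (le_trans mC)// lerDl mulr_ge0// ltW.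
apply: le_trans (xC n); apply: le_trans (admissible_sum_le (x n) Aadm).
rewrite big_seq [leRHS]big_seq; apply: ler_sum => j /Ap; rewrite -leqNgt => jp.
by rewrite -[(v + x n : schreier K) j]/(v0 j + x n j) vp// add0r.
Unshelve. all: by end_near. Qed.

End SchreierGrow.

(** The maps [phi b] stand for the real coordinates of a scalar; they reduce the claim to
    real-valued polynomials, for which suprema make sense. *)
Lemma linfty_polynomially_null {R : realType} {K : scalarFieldType R}
    (phi : bool -> K -> R) (x : nat -> schreier K) (C : R) :
  (forall b, {morph phi b : u v / u - v}) ->
  (forall b u, `|phi b u| <= modulus u) ->
  (forall u, modulus u <= `|phi true u| + `|phi false u|) ->
  (forall n, snorm (x n) <= C) ->
  (forall e : R, 0 < e -> \forall n \near \oo, forall j, modulus (x n j) <= e) ->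
  polynomially_null x.
Proof.
move=> phiB phi_le le_phi xC x0 k _ P Phom Pcont.
have H b : phi b (P (x n)) @[n --> \oo] --> phi b (P 0).
  apply: (@frechet_cvg _ _ snorm x C _ snormD (snorm_add_near xC x0) k (fun u => phi b (P u))).
  - by rewrite snorm0 (le_trans (snorm_ge0 (x 0%N))).
  - exact: (frechet_comp (phiB b) (frechet_homogeneous Phom)).
  - move=> r; have [r0|r0] := leP 0 r; last first.
      by exists 0 => u ur; have := lt_le_trans r0 (snorm_ge0 u); rewrite ltNge ur.
    have [c cP] := homogeneous_bounded Phom (Pcont 0) r0.
    exists c => u ur; apply: le_trans (phi_le _ _) _.
    by apply: cP; rewrite snormE ler_of_real.
apply/cvgrPdist_lt => e /gt0_of_real[d d0 ->].
have d20 : 0 < d / 2 by rewrite divr_gt0.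
near=> n; rewrite normr_modulus ltr_of_real; apply: le_lt_trans (le_phi _) _.
rewrite [ltRHS]splitr !phiB; apply: ltrD.
  by near: n; have /cvgrPdist_lt := H true; exact.
by near: n; have /cvgrPdist_lt := H false; exact.
Unshelve. all: by end_near. Qed.

(** * Level sets and sums of squares *)

Section Interpolation.
Context {R : realType}.
Variables (a : nat -> R) (C : R).
Hypothesis a0 : forall j, 0 <= a j.
Hypothesis aC : forall s : seq nat, uniq s ->
  (forall j, j \in s -> (size s <= j.+1)%N) -> \sum_(j <- s) a j <= C.

(* The upper half of a level set is admissible. *)
Lemma size_level_set (s : seq nat) (t : R) : uniq s -> 0 <= t ->
  (forall j, j \in s -> t <= a j) -> (size s)%:R * t <= 2 * C.
Proof.
(* At most [N./2] distinct indices lie below [N./2], so [g] keeps at least [uphalf N] of them.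
   Taking exactly that many gives an admissible set, as [uphalf N <= N./2 + 1] and index [j] allows
   [j + 1] elements. *)
move=> us t0 st; pose N := size s; pose g := [seq j <- s | (N./2 <= j)%N].
pose s' := take (uphalf N) g.
have sz : size s' = uphalf N.
  apply: size_takel; rewrite size_filter.
  have := count_predC (fun j => N./2 <= j)%N s; rewrite -/N.
  have : (count (predC (fun j => N./2 <= j)%N) s <= N./2)%N.
    rewrite -size_filter -[leqRHS](size_iota 0); apply: uniq_leq_size.
      exact: filter_uniq.
    by move=> j; rewrite mem_filter mem_iota /= -ltnNge => /andP[].
  have := uphalf_half N; have := odd_double_half N; lia.
have sg j : j \in s' -> (N./2 <= j)%N /\ j \in s.
  by move=> /mem_take; rewrite mem_filter => /andP[].
have us' : uniq s' by rewrite take_uniq// filter_uniq.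
have : \sum_(j <- s') a j <= C.
  apply: aC => // j /sg[jN _]; rewrite sz uphalf_half.
  by case: (odd N); rewrite ?add0n ?add1n ?ltnS// leqW.
have : (uphalf N)%:R * t <= \sum_(j <- s') a j.
  rewrite -sz mulr_natl -[leLHS]addr0 -iter_addr -(count_predT s') -big_const_seq.
  by rewrite big_seq [leRHS]big_seq; apply: ler_sum => j /sg[_ /st].
have : N%:R * t <= 2 * ((uphalf N)%:R * t).
  rewrite mulrA ler_wpM2r// -natrM ler_nat.
  have := uphalf_half N; have := odd_double_half N; lia.
by lra.
Qed.

Lemma exists_max_seq (s : seq nat) : s != [::] ->
  exists2 i, i \in s & forall j, j \in s -> a j <= a i.
Proof.
elim: s => // i [|k s] IHs _; first by exists i => [|j]; rewrite inE// => /eqP ->.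
have [l ls lmax] := IHs isT; have [il|li] := leP (a i) (a l).
  exists l => [|j]; first by rewrite inE ls orbT.
  by rewrite inE => /orP[/eqP ->//|/lmax].
exists i => [|j]; first by rewrite inE eqxx.
by rewrite inE => /orP[/eqP ->//|/lmax jl]; exact: le_trans jl (ltW li).
Qed.

(** Let [2 * b] be the largest term. Terms above [b] number at most [2 * C / b] and contribute at
    most [8 * C * b]; the others contribute as much by induction on the size, since the largest term
    has been removed. The total is [8 * C * (2 * b)]. *)
Lemma sum_sqr_le (s : seq nat) m : uniq s -> 0 <= m ->
  (forall j, j \in s -> a j <= m) -> \sum_(j <- s) a j ^+ 2 <= 8 * C * m.
Proof.
have C0 : 0 <= C by have := aC (s := [::]) isT; rewrite big_nil; exact.
have [n] := ubnP (size s); elim: n s m => // n IHn s m sn us m0 sm.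
have [->|s0] := eqVneq s [::]; first by rewrite big_nil mulr_ge0// mulr_ge0.
have [i is_ imax] := exists_max_seq s0.
apply: (@le_trans _ _ (8 * C * a i)); last first.
  by rewrite ler_wpM2l ?sm// mulr_ge0.
pose b := a i / 2.
have [ai0|ai0] := leP (a i) 0.
  rewrite big_seq big1 ?mulr_ge0// => j /imax ji; have -> : a j = 0.
    by apply/eqP; rewrite eq_le a0 (le_trans ji).
  by rewrite expr0n.
have b0 : 0 < b by rewrite divr_gt0.
pose g := [seq j <- s | b < a j]; pose r := [seq j <- s | ~~ (b < a j)].
rewrite (bigID (fun j => b < a j))/= -!(big_filter s) -/g -/r.
have : \sum_(j <- r) a j ^+ 2 <= 8 * C * b.
  apply: IHn; rewrite ?filter_uniq ?(ltW b0)//.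
    rewrite -ltnS; apply: leq_trans sn; rewrite ltnS size_filter -(count_predC (fun j => b < a j) s).
    by rewrite -[ltnLHS]add0n ltn_add2r -has_count; apply/hasP; exists i => //; rewrite /b; lra.
  by move=> j; rewrite mem_filter -leNgt => /andP[].
have : (size g)%:R * b <= 2 * C.
  apply: size_level_set; rewrite ?filter_uniq ?(ltW b0)//.
  by move=> j; rewrite mem_filter => /andP[/ltW].
have : \sum_(j <- g) a j ^+ 2 <= (size g)%:R * a i ^+ 2.
  rewrite mulr_natl -[leRHS]addr0 -iter_addr -(count_predT g) -big_const_seq.
  rewrite big_seq [leRHS]big_seq; apply: ler_sum => j; rewrite mem_filter => /andP[_ /imax ji].
  by rewrite lerXn2r ?nnegrE ?(le_trans (a0 j)).
rewrite (_ : a i = 2 * b); last by rewrite /b mulrC divfK.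
move=> h1 h2 h3.
have : (size g)%:R * (2 * b) ^+ 2 <= 8 * C * b.
  by have := ler_wpM2r (ltW b0) h2; lra.
by lra.
Qed.

End Interpolation.

(** * The sup and square-sum norms in terms of coordinates *)

Section SequenceNorms.
Context {R : realType} {K : scalarFieldType R}.
Implicit Types x : nat -> K.

Lemma sum_modulus_le (u : schreier K) (s : seq nat) : uniq s ->
  (forall j, j \in s -> (size s <= j.+1)%N) -> \sum_(j <- s) modulus (u j) <= snorm u.
Proof.
move=> us sadm; pose A := [fset j in s]%fset.
have As : perm_eq s A by apply: uniq_perm; rewrite ?fset_uniq// => j; rewrite in_fset.
rewrite (perm_big _ As); apply: admissible_sum_le => j.
by rewrite in_fset -(perm_size As); exact: sadm.
Qed.

Lemma sum_modulus_sqr_le (u : schreier K) (s : seq nat) m : uniq s -> 0 <= m ->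
  (forall j, modulus (u j) <= m) -> \sum_(j <- s) modulus (u j) ^+ 2 <= 8 * snorm u * m.
Proof.
move=> us m0 um; apply: sum_sqr_le => // [j|]; first exact: modulus_ge0.
exact: sum_modulus_le.
Qed.

(** Only the empty set is null for the counting measure, so the essential supremum is a supremum. *)
Lemma linfty_normP x (e : R) :
  (linfty_norm x <= e%:E)%E <-> forall j, modulus (x j) <= e.
Proof.
(* The norm at infinite exponent is defined by cases on whether the whole space has positive
   measure. *)
rewrite /linfty_norm unlock; have -> : (0 < counting [set: nat])%E.
  by rewrite /counting; case: asboolP => // /infinite_nat.
split=> [/ess_supP[N [_ N0 xN]] j|xe]; last first.
  by apply/ess_supP/nearW => j /=; rewrite ger0_norm ?modulus_ge0// lee_fin.
apply: contrapT => xj; have : N j.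
  apply: (xN j) => /= h; apply: xj.
  by move: h; rewrite ger0_norm ?modulus_ge0// lee_fin.
move: N0; rewrite /= /counting; case: asboolP => // Nfin [] /eqP.
by rewrite pnatr_eq0 cardfs_eq0 => /eqP/(fset_set_set0 Nfin) ->.
Qed.

Lemma l2_normE x : l2_norm x = ((\sum_(k <oo) (modulus (x k) ^+ 2)%:E) `^ 2^-1)%E.
Proof.
rewrite /l2_norm Lnorm_counting//; congr poweR; apply: eq_eseriesr => k _.
by rewrite /= ger0_norm ?modulus_ge0// powR_mulrn ?modulus_ge0.
Qed.

Lemma modulus_le_l2 x j : ((modulus (x j))%:E <= l2_norm x)%E.
Proof.
have h0 k : (0 <= (modulus (x k) ^+ 2)%:E)%E by rewrite lee_fin sqr_ge0.
(* The left side is written as the square root of its square, so that monotonicity of the root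
   leaves one term against the sum of squares. *)
rewrite l2_normE -[leLHS]poweRe1 ?lee_fin ?modulus_ge0// -[in leLHS](@mulfV _ (2 : R))// poweRrM.
rewrite [X in (X `^ _)%E]poweR_EFin powR_mulrn ?modulus_ge0//.
apply: gt0_ler_poweR; rewrite ?invr_ge0// ?in_itv/= ?leey ?andbT ?lee_fin ?sqr_ge0 ?nneseries_ge0//.
apply: le_trans (nneseries_lim_ge j.+1 (fun k _ _ => h0 k)).
by rewrite big_nat_recr//= leeDr// sume_ge0.
Qed.

Lemma l2_norm_le x c : 0 <= c ->
  (forall s : seq nat, uniq s -> \sum_(j <- s) modulus (x j) ^+ 2 <= c ^+ 2) ->
  (l2_norm x <= c%:E)%E.
Proof.
move=> c0 xc; have h0 k : (0 <= (modulus (x k) ^+ 2)%:E)%E by rewrite lee_fin sqr_ge0.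
rewrite l2_normE -[leRHS]poweRe1// -[in leRHS](@mulfV _ (2 : R))// poweRrM.
rewrite [X in (_ <= X `^ _)%E]poweR_EFin powR_mulrn//.
apply: gt0_ler_poweR; rewrite ?invr_ge0// ?in_itv/= ?leey ?andbT ?lee_fin ?sqr_ge0 ?nneseries_ge0//.
apply: lime_le.
  exact: is_cvg_nneseries.
by apply: nearW => n; rewrite sumEFin lee_fin xc// iota_uniq.
Qed.

End SequenceNorms.

(* Baire category on the product of countably many copies of T. *)
Lemma pointwise_null_cylinder {R : realType} {T : Type} (phi : nat -> (nat -> T) -> R) (e : R) :
  inhabited T ->
  (forall n t, e < phi n t -> exists m, forall t',
     (forall j, (j < m)%N -> t' j = t j) -> e < phi n t') ->
  (forall t, \forall n \near \oo, phi n t <= e) ->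
  exists t0 m N, forall n t, (N <= n)%N ->
    (forall j, (j < m)%N -> t j = t0 j) -> phi n t <= e.
Proof.
move=> [tau] phi_open phi0; apply: contrapT => Nphi.
(* A pair [(t, m)] encodes the cylinder of sequences agreeing with [t] below [m]. If the conclusion
   fails, each cylinder contains a longer one on which some [phi n], with [n] at least [m], exceeds
   [e]. *)
have step (p : (nat -> T) * nat) : exists q : (nat -> T) * nat * nat,
    [/\ (p.2 < q.1.2)%N, (p.2 <= q.2)%N, (forall j, (j < p.2)%N -> q.1.1 j = p.1 j) &
      forall t, (forall j, (j < q.1.2)%N -> t j = q.1.1 j) -> e < phi q.2 t].
  apply: contrapT => Np; apply: Nphi; exists p.1, p.2, p.2 => n t pn tp.
  rewrite leNgt; apply/negP => /[dup] /phi_open[m mP] phint.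
  apply: Np; exists (t, (maxn p.2.+1 m), n); split => //=; first by rewrite leq_max leqnn.
  by move=> t' t't; apply: mP => j jm; apply: t't; rewrite leq_max jm orbT.
have [f fP] := choice step.
pose s := fix s k := if k is k'.+1 then (f (s k')).1 else (fun=> tau, 0%N).
have sm k : ((s k).2 < (s k.+1).2)%N by case: (fP (s k)).
have km k : (k <= (s k).2)%N.
  by elim: k => // k IHk; exact: leq_ltn_trans IHk (sm k).
have mono k d : ((s k).2 <= (s (k + d)).2)%N.
  by elim: d => [|d IHd]; [rewrite addn0|rewrite addnS (leq_trans IHd)// ltnW].
have agree k d j : (j < (s k).2)%N -> (s (k + d)%N).1 j = (s k).1 j.
  move=> jk; elim: d => [|d IHd]; [by rewrite addn0|rewrite addnS -IHd].
  by case: (fP (s (k + d)%N)) => _ _ + _; apply; apply: leq_trans (mono k d).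
(* By [km], coordinate [j] is already fixed at stage [j.+1], so this diagonal sequence lies in all
   the nested cylinders. *)
pose w j := (s j.+1).1 j.
have wE k j : (j < (s k).2)%N -> w j = (s k).1 j.
  move=> jk; rewrite /w; have [kj|jk'] := leqP k j.+1.
    by rewrite -(subnKC kj) agree.
  by rewrite -(subnKC (ltnW jk')) agree// (leq_trans _ (km _)).
have [N _ NP] := phi0 w.
(* Stage [N] yields an index at least [(s N).2], hence at least [N], at which [phi] exceeds [e] on
   [w]. *)
case: (fP (s N)) => _ Nq _ /(_ w (wE N.+1)); rewrite ltNge NP//=.
exact: leq_trans (km N) Nq.
Qed.

(** * Limits and series of scalars *)

Section Series.
Context {R : realType} {K : scalarFieldType R}.

Lemma modulus_sum (I : Type) (s : seq I) (a : I -> K) :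
  modulus (\sum_(i <- s) a i) <= \sum_(i <- s) modulus (a i).
Proof.
elim: s => [|i s IHs]; first by rewrite !big_nil modulus0.
by rewrite !big_cons (le_trans (modulusD _ _))// lerD2l.
Qed.

Lemma cvg_modulusP (u : nat -> K^o) (l : K^o) :
  u n @[n --> \oo] --> l <->
  forall e : R, 0 < e -> \forall n \near \oo, modulus (l - u n) < e.
Proof.
split=> [/cvgrPdist_lt ul e e0|ul].
  have /ul : 0 < of_real e :> K by rewrite -of_real0 ltr_of_real.
  by apply: filterS => n; rewrite normr_modulus ltr_of_real.
apply/cvgrPdist_lt => _ /gt0_of_real[e e0 ->]; apply: filterS (ul e e0) => n.
by move=> h; rewrite normr_modulus ltr_of_real.
Qed.

Lemma modulus_cvg_le (u : nat -> K^o) (l : K^o) (c : R) :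
  u n @[n --> \oo] --> l -> (\forall n \near \oo, modulus (u n) <= c) -> modulus l <= c.
Proof.
move=> /cvg_modulusP ul uc; apply/ler_addgt0Pr => e e0.
have [n [un ln]] := filter_ex (filterI uc (ul e e0)).
by rewrite -(subrK (u n) l) (le_trans (modulusD _ _))// addrC lerD// ltW.
Qed.

(** Comparison test, with completeness of [K] taken from [modulus_complete]. *)
Lemma modulus_series_cvg (a : nat -> K^o) (b : nat -> R) :
  (forall k, modulus (a k) <= b k) -> cvgn (series b) -> cvgn (series a).
Proof.
move=> ab /cauchy_cvgP/cauchy_seriesP bC.
have [l al] : exists l : K, forall e : R, 0 < e -> exists N, forall n,
    (N <= n)%N -> modulus (series a n - l) < e.
  apply: modulus_complete => e e0.
  have [[A1 A2] [[N1 _ A1N] [N2 _ A2N]] AP] := bC e e0.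
  have H m n : (maxn N1 N2 <= m)%N -> (m <= n)%N -> modulus (series a n - series a m) < e.
    rewrite geq_max => /andP[N1m N2m] mn; rewrite sub_series_geq//.
    apply: le_lt_trans (modulus_sum _ _) _.
    have := AP (m, n) (conj (A1N m N1m) (A2N n (leq_trans N2m mn))) => /=.
    by apply: le_lt_trans; rewrite (le_trans _ (ler_norm _))// ler_sum.
  exists (maxn N1 N2) => m n Nm Nn.
  have [mn|nm] := leqP m n; last exact: H (ltnW nm).
  by rewrite -modulusN opprB H.
apply/cvg_ex; exists l; apply/cvg_modulusP => e /al[N NP].
by exists N => // n /NP; rewrite -modulusN opprB.
Qed.

End Series.

(** * Series of polynomials with a free parameter in each term *)

Section SeriesFamily.
Context {R : realType} {K : scalarFieldType R} {E : normedModType K}.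
Variables (T : Type) (d : nat) (M : nat -> T -> ('I_d -> E) -> K^o).
Hypothesis d0 : (0 < d)%N.
Hypothesis Mlin : forall k t, multilinear (M k t).
(** The majorant [b] is independent of the parameters: this gives convergence for every choice of
    them and continuity in the product topology. *)
Hypothesis Msum : forall v, exists2 b : nat -> R, cvgn (series b) &
  forall k t, modulus (M k t v) <= b k.
Hypothesis Mcont : forall (u : E) (e : R), 0 < e -> \forall y \near u,
  forall t n, modulus (\sum_(0 <= k < n) (M k (t k) (fun=> y) - M k (t k) (fun=> u))) <= e.

Let S t v : K^o := limn (series (fun k => M k (t k) v)).

Let S_cvg t v : series (fun k => M k (t k) v) @ \oo --> S t v.
Proof. by have [b bC Mb] := Msum v; apply: modulus_series_cvg bC. Qed.
Arguments S_cvg : clear implicits.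

Let S_lin t : multilinear (S t).
Proof.
move=> i v a y z /=; apply: cvg_lim; first exact: norm_hausdorff.
apply: (cvg_trans _ (cvgD (cvgZ (cvg_cst a) (S_cvg t (@dfwith _ (fun=> E) v i y)))
  (S_cvg t (@dfwith _ (fun=> E) v i z)))).
apply: near_eq_cvg; near=> n.
rewrite -[LHS]/(a * _ + _) /series /= mulr_sumr -big_split/=; apply: eq_bigr => k _.
by rewrite (Mlin k (t k) i v a y z).
Unshelve. all: by end_near. Qed.

Let S_cvgB t t' v v' :
  (\sum_(0 <= k < n) (M k (t k) v - M k (t' k) v') : K^o) @[n --> \oo] --> S t v - S t' v'.
Proof.
apply: (cvg_trans _ (cvgB (S_cvg t v) (S_cvg t' v'))); apply: near_eq_cvg.
by near=> n; rewrite -[LHS]/(_ - _) /series /= -sumrB.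
Unshelve. all: by end_near. Qed.
Arguments S_cvgB : clear implicits.

Let S_cont t : continuous (fun u => S t (fun=> u)).
Proof.
move=> u; apply/cvgrPdist_lt => _ /gt0_of_real[e e0 ->].
have e20 : 0 < e / 2 by rewrite divr_gt0.
apply: filterS (Mcont u e20) => y Hy.
rewrite distrC normr_modulus ltr_of_real; apply: (@le_lt_trans _ _ (e / 2)).
  by apply: modulus_cvg_le (S_cvgB t t _ _) _; apply: nearW => n; exact: Hy.
by rewrite ltr_pdivrMr// ltr_pMr// ltr1n.
Qed.

Arguments S_cont : clear implicits.

(** Parameters agreeing up to a Cauchy rank of the majorant give sums differing by at most twice a
    tail, that is [2 * g], half of the available gap. *)
Let S_open (u : E) (e : R) t : e < modulus (S t (fun=> u)) ->
  exists m, forall t', (forall j, (j < m)%N -> t' j = t j) -> e < modulus (S t' (fun=> u)).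
Proof.
move=> eS; pose g := (modulus (S t (fun=> u)) - e) / 4.
have g0 : 0 < g by rewrite divr_gt0// subr_gt0.
have [b /cauchy_cvgP/cauchy_seriesP bC Mb] := Msum (fun=> u).
have [[A1 A2] [[N1 _ A1N] [N2 _ A2N]] AP] := bC g g0.
pose m := maxn N1 N2; exists m => t' t't.
suff : modulus (S t (fun=> u) - S t' (fun=> u)) <= 2 * g.
  have := modulusD (S t (fun=> u) - S t' (fun=> u)) (S t' (fun=> u)).
  by rewrite subrK /g; move: g0; rewrite /g; lra.
apply: modulus_cvg_le (S_cvgB t t' _ _) _; near=> n.
have mn : (m <= n)%N by near: n; exact: nbhs_infty_ge.
rewrite (big_cat_nat (leq0n m) mn)/= big_nat big1 ?add0r; last first.
  by move=> k /andP[_ km]; rewrite t't// subrr.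
apply: le_trans (modulus_sum _ _) _.
apply: (@le_trans _ _ (\sum_(m <= k < n) 2 * b k)).
  apply: ler_sum => k _; apply: le_trans (modulusD _ _) _.
  by rewrite modulusN mulr_natl mulr2n lerD.
rewrite -mulr_sumr ler_wpM2l//.
have := AP (m, n) (conj (A1N m (leq_maxl _ _)) (A2N n (leq_trans (leq_maxr _ _) mn))).
by move=> /= /ltW; apply: le_trans; exact: ler_norm.
Unshelve. all: by end_near. Qed.

(* The polynomials u |-> \sum_k M k (t k) u, for t : nat -> T, are all tested
   on x; on a cylinder where they are uniformly small, two values of t
   differing at the single index k isolate the k-th term. *)
Lemma polynomially_null_family (x : nat -> E) : inhabited T ->
  polynomially_null x -> forall e : R, 0 < e ->
  exists m N, forall n k t t', (N <= n)%N -> (m <= k)%N ->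
    modulus (M k t (fun=> x n) - M k t' (fun=> x n)) <= e.
Proof.
move=> T0 x0 e e0; have e20 : 0 < e / 2 by rewrite divr_gt0.
have S_null t : \forall n \near \oo, modulus (S t (fun=> x n)) <= e / 2.
  have hom : homogeneous_polynomial d (fun u => S t (fun=> u)) by exists (S t).
  have := x0 d d0 _ hom (S_cont t).
  have -> : S t (fun=> 0) = 0.
    have := multilinear_diag_scale (S_lin t) 0 0.
    by rewrite scale0r expr0n -[d == 0%N]negbK -lt0n d0 mul0r.
  move=> /cvg_modulusP/(_ _ e20); apply: filterS => n.
  by rewrite sub0r modulusN => /ltW.
have [t0 [m [N H]]] := pointwise_null_cylinder T0
  (fun n t => @S_open (x n) (e / 2) t) S_null.
exists m, N => n k t t' Nn mk.
pose w tau j := if j == k then tau else t0 j.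
have wm tau j : (j < m)%N -> w tau j = t0 j.
  by move=> jm; rewrite /w ltn_eqF// (leq_trans jm).
have -> : M k t (fun=> x n) - M k t' (fun=> x n) =
    S (w t) (fun=> x n) - S (w t') (fun=> x n).
  apply: (cvg_unique (@norm_hausdorff _ _) _ (S_cvgB (w t) (w t') (fun=> x n) (fun=> x n))).
  (* All terms but the [k]-th cancel, so the partial sums of the difference are constant once [p]
     exceeds [k]. *)
  apply: cvg_near_cst; near=> p.
  have kp : (k < p)%N by near: p; exact: nbhs_infty_gt.
  rewrite big_mkord (bigD1 (Ordinal kp))//= /w eqxx big1 ?addr0// => i ik.
  have /negPf -> : nat_of_ord i != k by apply: contraNneq ik => ik; exact/eqP/val_inj.
  by rewrite subrr.
apply: le_trans (modulusD _ _) _; rewrite modulusN [leRHS]splitr.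
by apply: lerD; apply: H => // j; exact: wm.
Unshelve. all: by end_near. Qed.

End SeriesFamily.

(** * Consequences of polynomial nullity in Schreier's space *)

Section PolynomiallyNullSchreier.
Context {R : realType} {K : scalarFieldType R}.
Implicit Types (u v y : schreier K).

Lemma cvgn_series_bounded (b : nat -> R) (c : R) : (forall k, 0 <= b k) ->
  (forall n, \sum_(0 <= k < n) b k <= c) -> cvgn (series b).
Proof.
move=> b0 bc; apply: nondecreasing_is_cvgn; first exact: nondecreasing_series.
by exists c => _ [n _ <-]; exact: bc.
Qed.

Lemma sum_geometric_half_le (n : nat) : \sum_(0 <= k < n) 2^-1 ^+ k <= 2 :> R.
Proof.
suff -> : \sum_(0 <= k < n) 2^-1 ^+ k = 2 - 2 * 2^-1 ^+ n :> R.
  by rewrite lerBlDr lerDl mulr_ge0// exprn_ge0.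
elim: n => [|n IHn]; first by rewrite big_geq// expr0 mulr1 subrr.
by rewrite big_nat_recr//= IHn exprS; lra.
Qed.

(** With [a] and [b] the norms of [u] and [v], expand the square of
    [b * modulus (u j) - a * modulus (v j)] and sum using the bound [8 * snorm w * snorm w] on sums
    of squares. Zero norms are treated apart because the inequality is multiplied by
    [2 * (a * b)]. *)
Lemma sum_modulusM_le u v (s : seq nat) : uniq s ->
  \sum_(j <- s) modulus (u j) * modulus (v j) <= 8 * snorm u * snorm v.
Proof.
move=> us.
have sq (w : schreier K) : \sum_(j <- s) modulus (w j) ^+ 2 <= 8 * snorm w * snorm w.
  by apply: sum_modulus_sqr_le => // [|j]; rewrite ?snorm_ge0 ?modulus_le_snorm.
have null (w : schreier K) : snorm w = 0 -> forall j, modulus (w j) = 0.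
  move=> w0 j; apply/eqP; rewrite eq_le modulus_ge0 andbT -w0.
  exact: modulus_le_snorm.
have [/null u0|u0] := eqVneq (snorm u) 0.
  by rewrite big1 ?mulr_ge0 ?snorm_ge0// => j _; rewrite u0 mul0r.
have [/null v0|v0] := eqVneq (snorm v) 0.
  by rewrite big1 ?mulr_ge0 ?snorm_ge0// => j _; rewrite v0 mulr0.
set a := snorm u; set b := snorm v.
have a0 : 0 < a by rewrite lt_neqAle eq_sym u0 snorm_ge0.
have b0 : 0 < b by rewrite lt_neqAle eq_sym v0 snorm_ge0.
have ab0 : 0 < 2 * (a * b) by rewrite !mulr_gt0.
rewrite -(ler_pM2l ab0).
apply: (@le_trans _ _ (\sum_(j <- s) (b ^+ 2 * modulus (u j) ^+ 2 + a ^+ 2 * modulus (v j) ^+ 2))).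
  rewrite mulr_sumr; apply: ler_sum => j _.
  have := sqr_ge0 (b * modulus (u j) - a * modulus (v j)); nra.
rewrite big_split/= -!mulr_sumr.
have := ler_wpM2l (sqr_ge0 b) (sq u); have := ler_wpM2l (sqr_ge0 a) (sq v).
by rewrite -/a -/b; nra.
Qed.

Lemma snorm_near u (e : R) : 0 < e -> \forall y \near u, snorm (y - u) < e.
Proof.
move=> e0; have /nbhs_ballP : nbhs u (ball u (of_real e : K)).
  by apply: nbhsx_ballx; rewrite -of_real0 ltr_of_real.
move=> [r /= r0 ru]; apply/nbhs_ballP; exists r => //= y /ru.
by rewrite -ball_normE/= distrC snormE ltr_of_real.
Qed.

(** The weights [w j] rotate [u j] onto its modulus; as [0 / 0 = 0], they vanish where [u j]
    does. *)
Lemma norming_functional u (A : {fset nat}) : admissible A ->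
  exists f : schreier K -> K^o, [/\ linear f, forall y, modulus (f y) <= snorm y &
    f u = of_real (\sum_(j <- A) modulus (u j))].
Proof.
move=> Aadm; pose w j : K := `|u j : K| / u j.
have w1 j : modulus (w j) <= 1.
  rewrite -(ler_of_real (s := K)) of_real1 -normr_modulus normrM normr_id normfV.
  by have [->|u0] := eqVneq (u j : K) 0; rewrite ?normr0 ?mul0r// divff// normr_eq0.
exists (fun y => \sum_(j <- A) w j * y j); split.
- move=> a y z; rewrite scaler_sumr -big_split/=; apply: eq_bigr => j _.
  rewrite -[LHS]/(w j * (a * y j + z j)) -[RHS]/(a * (w j * y j) + w j * z j).
  by rewrite mulrDr mulrCA.
- move=> y; apply: le_trans (modulus_sum _ _) _; apply: le_trans (admissible_sum_le y Aadm).
  by apply: ler_sum => j _; rewrite modulusM ler_piMl ?modulus_ge0.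
rewrite (big_morph _ of_realD of_real0); apply: eq_bigr => j _.
have [->|u0] := eqVneq (u j : K) 0; first by rewrite mulr0 modulus0 of_real0.
by rewrite /w mulfVK// normr_modulus.
Qed.

(** The degree 1 case of the family, with parameters in the dual unit ball [T] and weights
    [2^-1 ^+ k] ensuring summability. *)
Lemma polynomially_null_bounded (x : nat -> schreier K) :
  polynomially_null x -> exists C : R, forall n, snorm (x n) <= C.
Proof.
move=> x0.
pose T := {f : schreier K -> K^o | linear f /\ forall y, modulus (f y) <= snorm y}.
pose h k : K := of_real (2^-1 ^+ k).
have hE k : modulus (h k) = 2^-1 ^+ k by rewrite modulus_of_real// exprn_ge0.
pose M k (t : T) (v : 'I_1 -> schreier K) : K^o := h k * (sval t (v ord0) : K).
have Mlin k t : multilinear (M k t).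
  move=> i v a y z; rewrite /M !dfwith_if (ord1 i) eqxx.
  by rewrite (proj1 (svalP t)) mulrDr mulrCA.
have MB (t : nat -> T) y u n :
    modulus (\sum_(0 <= k < n) (M k (t k) (fun=> y) - M k (t k) (fun=> u))) <=
    2 * snorm (y - u).
  apply: le_trans (modulus_sum _ _) _.
  apply: (@le_trans _ _ (\sum_(0 <= k < n) 2^-1 ^+ k * snorm (y - u))); last first.
    by rewrite -mulr_suml ler_wpM2r ?snorm_ge0// sum_geometric_half_le.
  apply: ler_sum => k _; rewrite /M -mulrBr modulusM hE ler_wpM2l ?exprn_ge0//.
  have -> : (sval (t k) y : K) - sval (t k) u = sval (t k) (y - u).
    transitivity (-1 * (sval (t k) u : K) + sval (t k) y); first by rewrite mulN1r addrC.
    apply: etrans (esym (proj1 (svalP (t k)) (-1) u y)) _.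
    by congr (sval _ _); rewrite scaleN1r addrC.
  exact: (proj2 (svalP (t k))).
pose zero : schreier K -> K^o := fun=> 0.
have zeroT : linear zero /\ forall y, modulus (zero y) <= snorm y.
  by split=> [a y z|y]; rewrite /zero ?scaler0 ?addr0// modulus0 snorm_ge0.
pose tz : T := exist _ zero zeroT.
have [|u e e0|m [N H]] := @polynomially_null_family R K _ T 1 M isT Mlin _ _ x (inhabits tz) x0 1 ltr01.
- move=> v; exists (fun k => 2^-1 ^+ k * snorm (v ord0)).
    apply: (@cvgn_series_bounded _ (2 * snorm (v ord0))) => [k|n].
      by rewrite mulr_ge0 ?exprn_ge0 ?snorm_ge0.
    by rewrite -mulr_suml ler_wpM2r ?snorm_ge0// sum_geometric_half_le.
  move=> k t; rewrite modulusM hE ler_wpM2l ?exprn_ge0//.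
  exact: (proj2 (svalP t)).
- have e20 : 0 < e / 2 by rewrite divr_gt0.
  apply: filterS (snorm_near u e20) => y yu t n; apply: le_trans (MB t y u n) _.
  by move: yu; lra.
have xN n : (N <= n)%N -> snorm (x n) <= 2 ^+ m.
  move=> Nn; apply: snorm_le => A Aadm.
  have [f [flin fb fx]] := norming_functional (x n) Aadm.
  (* Comparing [f] with the zero functional in the term of index [m] bounds [2^-1 ^+ m] times the
     norming value by 1. *)
  have := H n m (exist _ f (conj flin fb)) tz Nn (leqnn m).
  rewrite /M/= mulr0 subr0 modulusM hE fx modulus_of_real; last first.
    by apply: sumr_ge0 => j _; exact: modulus_ge0.
  by rewrite exprVn ler_pdivrMl ?exprn_gt0// mulr1.
exists (2 ^+ m + \sum_(i < N) snorm (x i)) => n.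
have S0 (P : pred 'I_N) : 0 <= \sum_(i < N | P i) snorm (x i).
  by apply: sumr_ge0 => i _; exact: snorm_ge0.
have [Nn|nN] := leqP N n; first by rewrite (le_trans (xN n Nn))// lerDl.
by rewrite (bigD1 (Ordinal nN))//= addrCA lerDl addr_ge0// exprn_ge0.
Qed.

(** Evaluation at [j] is a continuous 1-homogeneous polynomial. This settles the finitely many
    coordinates left out by the family argument. *)
Lemma polynomially_null_coord (x : nat -> schreier K) (j : nat) (e : R) :
  polynomially_null x -> 0 < e -> \forall n \near \oo, modulus (x n j) <= e.
Proof.
move=> x0 e0; pose P u : K^o := u j.
have Phom : homogeneous_polynomial 1 P.
  exists (fun v : 'I_1 -> schreier K => v ord0 j) => // i v a y z.
  by rewrite !dfwith_if (ord1 i) eqxx.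
have Pcont : continuous P.
  move=> u; apply/(@cvgrPdist_lt _ _ _ (nbhs u) _ P (P u)) => _ /gt0_of_real[d d0 ->].
  apply: filterS (snorm_near u d0) => y yu.
  rewrite distrC normr_modulus ltr_of_real; apply: le_lt_trans yu.
  exact: (modulus_le_snorm (y - u)).
have /cvg_modulusP/(_ e e0) := x0 1 isT P Phom Pcont.
by apply: filterS => n; rewrite sub0r modulusN => /ltW.
Qed.

(** The degree 2 case of the family: switching the [k]-th square on or off isolates [x n k ^+ 2],
    hence the tolerance [e ^+ 2]. *)
Lemma polynomially_null_linfty (x : nat -> schreier K) : polynomially_null x ->
  forall e : R, 0 < e -> \forall n \near \oo, forall j, modulus (x n j) <= e.
Proof.
move=> x0 e e0.
pose M k (b : bool) (v : 'I_2 -> schreier K) : K^o :=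
  if b then (v ord0 k * v ord_max k : K) else 0.
have Mlin k b : multilinear (M k b).
  move=> i v a y z; rewrite /M !dfwith_if; case: b; last by rewrite scaler0 addr0.
  rewrite -[(a *: y + z : schreier K)]/(a *: y + z).
  case: i => -[|[|//]] i2 /=.
    rewrite -[LHS]/((a * y k + z k) * v ord_max k).
    by rewrite -[RHS]/(a * (y k * v ord_max k) + z k * v ord_max k) mulrDl mulrA.
  rewrite -[LHS]/(v ord0 k * (a * y k + z k)).
  by rewrite -[RHS]/(a * (v ord0 k * y k) + v ord0 k * z k) mulrDr mulrCA.
(* Each difference of squares factors through [y - u] and [y + u], to which [sum_modulusM_le]
   applies. *)
have MB (t : nat -> bool) y u n :
    modulus (\sum_(0 <= k < n) (M k (t k) (fun=> y) - M k (t k) (fun=> u))) <=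
    8 * snorm (y - u) * snorm (y + u).
  apply: le_trans (modulus_sum _ _) _.
  apply: le_trans (sum_modulusM_le (y - u) (y + u) (iota_uniq 0 (n - 0))).
  apply: ler_sum => k _; rewrite /M; case: (t k); last first.
    by rewrite subrr modulus0 mulr_ge0 ?modulus_ge0.
  by rewrite -modulusM -[(y - u) k]/(y k - u k) -[(y + u) k]/(y k + u k) -subr_sqr !expr2.
have e20 : 0 < e ^+ 2 by rewrite exprn_gt0.
have [|u d d0|m [N H]] := @polynomially_null_family R K _ bool 2 M isT Mlin _ _ x
  (inhabits true) x0 (e ^+ 2) e20.
- move=> v; exists (fun k => modulus (v ord0 k) * modulus (v ord_max k)).
    apply: (@cvgn_series_bounded _ (8 * snorm (v ord0) * snorm (v ord_max))) => [k|n].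
      by rewrite mulr_ge0 ?modulus_ge0.
    exact: sum_modulusM_le (iota_uniq _ _).
  move=> k []; first by rewrite modulusM.
  by rewrite modulus0 mulr_ge0 ?modulus_ge0.
(* This bounds [snorm (y + u)] as soon as [snorm (y - u) < 1]. *)
- pose c := 2 * snorm u + 1.
  have c0 : 0 < c by rewrite ltr_wpDl// mulr_ge0// snorm_ge0.
  have r0 : 0 < d / (8 * c) by rewrite divr_gt0// mulr_gt0.
  near=> y => t n; apply: le_trans (MB t y u n) _.
  have y1 : snorm (y - u) < 1 by near: y; exact: snorm_near.
  have yd : snorm (y - u) < d / (8 * c) by near: y; exact: snorm_near.
  have yc : snorm (y + u) <= c.
    have -> : y + u = (y - u) + (u + u) by rewrite addrA subrK.
    rewrite (le_trans (snormD _ _))// /c addrC mulr_natl mulr2n lerD ?(ltW y1)//.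
    exact: snormD.
  apply: (@le_trans _ _ (8 * snorm (y - u) * c)).
    by rewrite ler_wpM2l// mulr_ge0// snorm_ge0.
  by rewrite mulrAC mulrC -ler_pdivlMr ?mulr_gt0// ltW.
have coord : \forall n \near \oo, forall j : 'I_m, modulus (x n j) <= e.
  by apply: filter_forall => j; exact: polynomially_null_coord.
near=> n.
have Nn : (N <= n)%N by near: n; exact: nbhs_infty_ge.
have xm : forall j : 'I_m, modulus (x n j) <= e by near: n.
move=> j; have [jm|mj] := ltnP j m; first exact: (xm (Ordinal jm)).
have := H n j true false Nn mj.
by rewrite /M subr0 modulusM -expr2 ler_pXn2r// nnegrE ?modulus_ge0// ltW.
Unshelve. all: by end_near. Qed.

End PolynomiallyNullSchreier.

(** * Assembling the equivalences *)

Section Schreier.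
Context {R : realType} {K : scalarFieldType R}.

Lemma cvge0P (f : nat -> \bar R) : (forall n, 0 <= f n)%E ->
  f n @[n --> \oo] --> 0%E <->
  forall e : R, 0 < e -> \forall n \near \oo, (f n <= e%:E)%E.
Proof.
move=> f0; split=> [/fine_cvgP[ffin /cvgrPdist_le fcvg] e e0|fe].
  apply: filterS2 ffin (fcvg e e0) => n fn; rewrite sub0r normrN.
  by rewrite /= ger0_norm ?fine_ge0// -lee_fin fineK.
have ffin : \forall n \near \oo, f n \is a fin_num.
  apply: filterS (fe 1 ltr01) => n fn; rewrite ge0_fin_numE//.
  exact: le_lt_trans fn (ltry _).
apply/fine_cvgP; split=> //; apply/cvgrPdist_le => e e0.
apply: filterS2 ffin (fe e e0) => n fn fne; rewrite sub0r normrN/=.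
by rewrite ger0_norm ?fine_ge0// -lee_fin fineK.
Qed.

Lemma schreier_boundedP (x : nat -> schreier K) :
  [bounded x n | n in [set: nat]] <-> exists C : R, forall n, snorm (x n) <= C.
Proof.
have PF : ProperFilter (globally [set: nat]) by exact: (@globally_properfilter _ _ 0%N).
split=> [/ex_bound[C xC]|[C xC]]; last first.
  by apply/ex_bound; exists (of_real C) => n _ /=; rewrite snormE ler_of_real.
exists (modulus C) => n; have xnC : `|x n| <= C by exact: xC.
rewrite -(ler_of_real (s := K)) -snormE -normr_modulus ger0_norm//.
exact: le_trans xnC.
Qed.

Lemma linfty_cvg0P (x : nat -> schreier K) :
  linfty_norm (x n) @[n --> \oo] --> 0%E <->
  forall e : R, 0 < e -> \forall n \near \oo, forall j, modulus (x n j) <= e.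
Proof.
apply: (iff_trans (cvge0P _)) => [n|]; first exact: Lnorm_ge0.
by split=> xe e /xe; apply: filterS => n /linfty_normP.
Qed.

Lemma bounded_linfty_l2 (x : nat -> schreier K) (C : R) :
  (forall n, snorm (x n) <= C) ->
  (forall e : R, 0 < e -> \forall n \near \oo, forall j, modulus (x n j) <= e) ->
  l2_norm (x n) @[n --> \oo] --> 0%E.
Proof.
move=> xC x0; apply/cvge0P => [n|e e0]; first exact: Lnorm_ge0.
have C0 : 0 <= C by rewrite (le_trans (snorm_ge0 (x 0%N))).
have C1 : 0 < 8 * C + 1 by rewrite ltr_wpDl// mulr_ge0.
(* This sup-norm tolerance makes the bound [8 * C * m] at most [e ^+ 2]; the added 1 covers
   [C = 0]. *)
have m0 : 0 < e ^+ 2 / (8 * C + 1) by rewrite divr_gt0// exprn_gt0.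
apply: filterS (x0 _ m0) => n xn; apply: l2_norm_le => [|s us]; first exact: ltW.
apply: le_trans (sum_modulus_sqr_le us (ltW m0) xn) _.
rewrite mulrCA ler_piMr ?exprn_ge0 ?(ltW e0)// ler_pdivrMr// mul1r.
by rewrite ler_wpDr// ler_wpM2l.
Qed.

(** The cycle is (a) to (b) to (c) to (a); its first arrow already passes through boundedness and
    sup-norm convergence. *)
Lemma schreier_tfae (phi : bool -> K -> R) :
  (forall b, {morph phi b : u v / u - v}) ->
  (forall b u, `|phi b u| <= modulus u) ->
  (forall u, modulus u <= `|phi true u| + `|phi false u|) ->
  forall x : nat -> schreier K,
  [<-> polynomially_null x;
       [bounded x n | n in [set: nat]] /\ l2_norm (x n) @[n --> \oo] --> 0%E;
       [bounded x n | n in [set: nat]] /\ linfty_norm (x n) @[n --> \oo] --> 0%E].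
Proof.
move=> phiB phi_le le_phi x; tfae => [x0|[xb xl2]|[/schreier_boundedP[C xC] /linfty_cvg0P x0]].
- have [C xC] := polynomially_null_bounded x0; split.
    by apply/schreier_boundedP; exists C.
  exact: bounded_linfty_l2 xC (polynomially_null_linfty x0).
- split=> //; apply/linfty_cvg0P => e e0.
  have /cvge0P/(_ _ e0) := xl2; move=> /(_ (fun n => Lnorm_ge0 _ _ _)).
  by apply: filterS => n xn j; rewrite -lee_fin; apply: le_trans xn; exact: modulus_le_l2.
- exact: linfty_polynomially_null phiB phi_le le_phi xC x0.
Qed.

End Schreier.

Theorem proposition14 (R : realType) :
  (forall x : nat -> schreier R,
     [<-> polynomially_null x;
          [bounded x n | n in [set: nat]] /\
            l2_norm (x n) @[n --> \oo] --> 0%E;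
          [bounded x n | n in [set: nat]] /\
            linfty_norm (x n) @[n --> \oo] --> 0%E]) /\
  (forall x : nat -> schreier R[i],
     [<-> polynomially_null x;
          [bounded x n | n in [set: nat]] /\
            l2_norm (x n) @[n --> \oo] --> 0%E;
          [bounded x n | n in [set: nat]] /\
            linfty_norm (x n) @[n --> \oo] --> 0%E]).
Proof.
(* A real scalar is its own first coordinate, with second coordinate 0; a complex one has its real
   and imaginary parts. *)
split; [apply: (@schreier_tfae R R (fun b r => if b then r else 0))
       |apply: (@schreier_tfae R R[i] (fun b z => if b then complex.Re z else complex.Im z))].
- by case=> u v //; rewrite subr0.
- by case=> u //; rewrite normr0 normr_ge0.
- by move=> u; rewrite normr0 addr0.
- by case=> u v; rewrite raddfB.
- case=> -[a b] /=; rewrite /modulus/= -sqrtr_sqr ler_sqrt ?addr_ge0 ?sqr_ge0//.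
    by rewrite lerDl sqr_ge0.
  by rewrite lerDr sqr_ge0.
- move=> [a b]; rewrite /modulus/= -[leRHS]ger0_norm ?addr_ge0// -sqrtr_sqr.
  rewrite ler_sqrt ?sqr_ge0// sqrrD !real_normK ?num_real// lerD2r lerDl.
  by rewrite mulrn_wge0// mulr_ge0.
Qed.
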